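(* Let $\mathcal{R}$ be a right-stable deterministic conditional term rewrite system (DCTRS) such that the unraveled TRS $\mathbb{U}_{seq}(\mathcal{R})$ is confluent and terminating. Then $\mathcal{R}$ is confluent (i.e. whenever $s \rightarrow^*_{\mathcal{R}} t_1$ and $s \rightarrow^*_{\mathcal{R}} t_2$ there is $w$ with $t_1 \rightarrow^*_{\mathcal{R}} w$ and $t_2 \rightarrow^*_{\mathcal{R}} w$).
   Context: Terms $\mathcal{T}=\mathcal{T}(\mathcal{F},\mathcal{V})$ over a signature $\mathcal{F}$ and a countably infinite set of variables $\mathcal{V}$. An (oriented) conditional rule has the form $l \rightarrow r \Leftarrow s_1 \rightarrow^* t_1, \ldots, s_k \rightarrow^* t_k$ ($k\ge 0$, $k=0$ meaning an unconditional rule). It is deterministic if $\mathcal{V}ar(r) \subseteq \mathcal{V}ar(l) \cup \mathcal{V}ar(s_1,t_1,\ldots,s_k,t_k)$ and $\mathcal{V}ar(s_i) \subseteq \mathcal{V}ar(l, t_1, \ldots, t_{i-1})$ for all $i$. A DCTRS $\mathcal{R}$ is a set of deterministic conditional rules; its underlying TRS is $\mathcal{R}_u=\{l\rightarrow r \mid l \rightarrow r \Leftarrow c \in \mathcal{R}\}$. The rewrite relation of $\mathcal{R}$: $\mathcal{R}_0=\emptyset$, $\mathcal{R}_{n+1}=\{l\sigma \rightarrow r\sigma \mid l \rightarrow r \Leftarrow s_1 \rightarrow^* t_1,\ldots,s_k\rightarrow^* t_k \in \mathcal{R},\ s_j\sigma \rightarrow^*_{\mathcal{R}_n} t_j\sigma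 \text{ for all } j\}$, and $u \rightarrow_{\mathcal{R}} v$ iff $u \rightarrow_{\mathcal{R}_n} v$ for some $n$ (ordinary rewriting with the unconditional rules of $\mathcal{R}_n$). $\mathcal{R}$ is right-stable if for every rule and every $i$, $t_i$ is either a linear constructor term (containing no root symbol of a left-hand side of $\mathcal{R}$) or a ground term irreducible w.r.t. $\mathcal{R}_u$, and $\mathcal{V}ar(t_i) \cap \mathcal{V}ar(l, s_1, t_1, \ldots, s_{i-1}, t_{i-1}, s_i) = \emptyset$. Sequential unraveling: for a conditional rule $\alpha: l \rightarrow r \Leftarrow s_1 \rightarrow^* t_1, \ldots, s_k \rightarrow^* t_k$ with $k\ge1$, let $X_i=\mathcal{V}ar(l,t_1,\ldots,t_{i-1})$ and $\vec{X_i}$ a fixed ordering of $X_i$; introduce fresh function symbols $U^\alpha_1,\ldots,U^\alpha_k$ and set $\mathbb{U}_{seq}(\alpha)=\{l \rightarrow U^\alpha_1(s_1,\vec{X_1})\}\cup\{U^\alpha_i(t_i,\vec{X_i}) \rightarrow U^\alpha_{i+1}(s_{i+1},\vec{X_{i+1}}) \mid 1\le i<k\}\cup\{U^\alpha_k(t_k,\vec{X_k}) \rightarrow r\}$; for an unconditional rule $\alpha$, $\mathbb{U}_{seq}(\alpha)=\{\alpha\}$. $\mathbb{U}_{seq}(\mathcal{R})=\bigcup_{\alpha\in\mathcal{R}}\mathbb{U}_{seq}(\alpha)$, an unconditional TRS over the extended signature. *)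

(* Defs.v *)
From Stdlib Require Import Relation_Operators.
From mathcomp Require Import all_boot.

Set Implicit Arguments.
Unset Strict Implicit.
Unset Printing Implicit Defensive.

(** * Terms *)

Record signature := Signature { sym :> Type; arity : sym -> nat }.

Unset Elimination Schemes.
Inductive term (F : signature) (V : Type) : Type :=
| Var (x : V)
| App (f : F) (a : {ffun 'I_(arity f) -> term F V}).
Set Elimination Schemes.

Arguments Var {F V} x.
Arguments App {F V} f a.

(* The automatically generated principle would have no induction hypothesis
   for the arguments. *)
Definition term_ind (F : signature) (V : Type) (P : term F V -> Prop)
    (PVar : forall x, P (Var x))
    (PApp : forall (f : F) (a : {ffun 'I_(arity f) -> term F V}),
              (forall i, P (a i)) -> P (App f a)) :=
  fix rec (t : term F V) : P t :=
    match t with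
    | Var x => PVar x
    | App f a => PApp f a (fun i => rec (a i))
    end.

(* Variables from left to right, with multiplicity. *)
Fixpoint vars (F : signature) (V : Type) (t : term F V) : seq V :=
  match t with
  | Var x => [:: x]
  | App f a => flatten [seq vars (a i) | i <- enum 'I_(arity f)]
  end.

Fixpoint occurs (F : signature) (V : Type) (g : F) (t : term F V) : Prop :=
  match t with
  | Var _ => False
  | App f a => f = g \/ exists i, occurs g (a i)
  end.

Definition linear (F : signature) (V : eqType) (t : term F V) : Prop :=
  uniq (vars t).

Definition ground (F : signature) (V : Type) (t : term F V) : Prop :=
  vars t = [::].

Fixpoint subst (F : signature) (V : Type) (sigma : V -> term F V)
    (t : term F V) : term F V :=
  match t with
  | Var x => sigma x
  | App f a => App f [ffun i => subst sigma (a i)]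
  end.

(** * Unconditional rewriting *)

Definition trs (F : signature) (V : Type) := term F V -> term F V -> Prop.

Definition set_arg (F : signature) (V : Type) (f : F)
    (a : {ffun 'I_(arity f) -> term F V}) (i : 'I_(arity f)) (u : term F V) :
    {ffun 'I_(arity f) -> term F V} :=
  [ffun j => if j == i then u else a j].

Inductive rstep (F : signature) (V : Type) (T : trs F V) :
    term F V -> term F V -> Prop :=
| rstep_root (l r : term F V) (sigma : V -> term F V) :
    T l r -> rstep T (subst sigma l) (subst sigma r)
| rstep_arg (f : F) (a : {ffun 'I_(arity f) -> term F V})
    (i : 'I_(arity f)) (u : term F V) :
    rstep T (a i) u -> rstep T (App f a) (App f (set_arg a i u)).

Definition star (A : Type) (S : A -> A -> Prop) : A -> A -> Prop :=
  clos_refl_trans A S.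

Definition confluent (A : Type) (S : A -> A -> Prop) : Prop :=
  forall s t1 t2, star S s t1 -> star S s t2 ->
  exists w, star S t1 w /\ star S t2 w.

Definition terminating (A : Type) (S : A -> A -> Prop) : Prop :=
  ~ exists u : nat -> A, forall n, S (u n) (u n.+1).

Definition irreducible (A : Type) (S : A -> A -> Prop) (t : A) : Prop :=
  ~ exists u, S t u.

(** * Conditional systems *)

(* The pairs in [conds] are the (s_i, t_i), for the conditions s_i ->* t_i. *)
Record crule (F : signature) (V : Type) := CRule {
  lhs : term F V;
  rhs : term F V;
  conds : seq (term F V * term F V)
}.

Definition ncond (F : signature) (V : Type) (alpha : crule F V) : nat :=
  size (conds alpha).

(* Conditions are numbered from 0. *)
Definition csrc (F : signature) (V : Type) (alpha : crule F V)
    (i : 'I_(ncond alpha)) : term F V :=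
  (tnth (in_tuple (conds alpha)) i).1.

Definition ctgt (F : signature) (V : Type) (alpha : crule F V)
    (i : 'I_(ncond alpha)) : term F V :=
  (tnth (in_tuple (conds alpha)) i).2.

Definition ctrs (F : signature) (V : Type) := crule F V -> Prop.

(* Var(l, t_1, .., t_{i-1}), where t_1, .., t_{i-1} are the right-hand sides
   of the conditions strictly before condition i. *)
Definition lt_vars (F : signature) (V : Type) (alpha : crule F V)
    (i : nat) : seq V :=
  vars (lhs alpha) ++ flatten [seq vars c.2 | c <- take i (conds alpha)].

(* Var(l, s_1, t_1, .., s_{i-1}, t_{i-1}). *)
Definition lst_vars (F : signature) (V : Type) (alpha : crule F V)
    (i : nat) : seq V :=
  vars (lhs alpha)
  ++ flatten [seq vars c.1 ++ vars c.2 | c <- take i (conds alpha)].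

Definition deterministic (F : signature) (V : eqType)
    (alpha : crule F V) : Prop :=
  {subset vars (rhs alpha) <= lst_vars alpha (ncond alpha)} /\
  forall i : 'I_(ncond alpha), {subset vars (csrc i) <= lt_vars alpha i}.

Definition dctrs (F : signature) (V : eqType) (R : ctrs F V) : Prop :=
  forall alpha, R alpha -> deterministic alpha.

Definition underlying (F : signature) (V : Type) (R : ctrs F V) : trs F V :=
  fun l r => exists alpha, [/\ R alpha, lhs alpha = l & rhs alpha = r].

Fixpoint level (F : signature) (V : Type) (R : ctrs F V) (n : nat) :
    trs F V :=
  match n with
  | 0 => fun _ _ => False
  | m.+1 => fun u v => exists (alpha : crule F V) (sigma : V -> term F V),
      [/\ R alpha, u = subst sigma (lhs alpha), v = subst sigma (rhs alpha)
        & forall j : 'I_(ncond alpha),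
            star (rstep (level R m)) (subst sigma (csrc j))
                                     (subst sigma (ctgt j))]
  end.

Definition cstep (F : signature) (V : Type) (R : ctrs F V)
    (u v : term F V) : Prop :=
  exists n, rstep (level R n) u v.

Definition defined_sym (F : signature) (V : Type) (R : ctrs F V)
    (g : F) : Prop :=
  exists (alpha : crule F V) (a : {ffun 'I_(arity g) -> term F V}),
    R alpha /\ lhs alpha = App g a.

Definition constructor_term (F : signature) (V : Type) (R : ctrs F V)
    (t : term F V) : Prop :=
  forall g, occurs g t -> ~ defined_sym R g.

Definition right_stable (F : signature) (V : eqType) (R : ctrs F V) : Prop :=
  forall alpha, R alpha -> forall i : 'I_(ncond alpha),
    ((linear (ctgt i) /\ constructor_term R (ctgt i)) \/
     (ground (ctgt i) /\ irreducible (rstep (underlying R)) (ctgt i))) /\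
    {in vars (ctgt i), forall x, x \notin lst_vars alpha i ++ vars (csrc i)}.

(** * Sequential unraveling *)

(* A choice of the sequences X_i for all rules. *)
Definition var_seqs (F : signature) (V : Type) :=
  forall alpha : crule F V, 'I_(ncond alpha) -> seq V.

Definition orders_vars (F : signature) (V : eqType) (R : ctrs F V)
    (X : var_seqs F V) : Prop :=
  forall alpha, R alpha -> forall i : 'I_(ncond alpha),
    uniq (X alpha i) /\ X alpha i =i lt_vars alpha i.

(* One fresh symbol for each rule of [R] and each condition of that rule, up to
   proof irrelevance for [urule_in]. *)
Record usym (F : signature) (V : Type) (R : ctrs F V) := USym {
  urule : crule F V;
  urule_in : R urule;
  uindex : 'I_(ncond urule)
}.

Definition ext_sig (F : signature) (V : Type) (R : ctrs F V)
    (X : var_seqs F V) : signature :=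
  @Signature (F + usym R)%type
    (fun g => match g with
              | inl f => arity f
              | inr u => (size (X (urule u) (uindex u))).+1
              end).

Fixpoint embed (F : signature) (V : Type) (R : ctrs F V) (X : var_seqs F V)
    (t : term F V) : term (ext_sig R X) V :=
  match t with
  | Var x => Var x
  | App f a => @App (ext_sig R X) V (inl f) [ffun i => embed R X (a i)]
  end.

(* The term U^alpha_i(u, X_i). *)
Definition uterm (F : signature) (V : Type) (R : ctrs F V) (X : var_seqs F V)
    (alpha : crule F V) (Ralpha : R alpha) (i : 'I_(ncond alpha))
    (u : term (ext_sig R X) V) : term (ext_sig R X) V :=
  @App (ext_sig R X) V (inr (USym Ralpha i))
    [ffun j => tnth [tuple of u :: map Var (in_tuple (X alpha i))] j].

Arguments uterm {F V R} X {alpha} Ralpha i u.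

Inductive useq (F : signature) (V : Type) (R : ctrs F V) (X : var_seqs F V) :
    term (ext_sig R X) V -> term (ext_sig R X) V -> Prop :=
| useq_uncond (alpha : crule F V) :
    R alpha -> ncond alpha = 0 ->
    useq (embed R X (lhs alpha)) (embed R X (rhs alpha))
| useq_first (alpha : crule F V) (Ra : R alpha) (i : 'I_(ncond alpha)) :
    i = 0 :> nat ->
    useq (embed R X (lhs alpha)) (uterm X Ra i (embed R X (csrc i)))
| useq_next (alpha : crule F V) (Ra : R alpha) (i j : 'I_(ncond alpha)) :
    j = i.+1 :> nat ->
    useq (uterm X Ra i (embed R X (ctgt i))) (uterm X Ra j (embed R X (csrc j)))
| useq_last (alpha : crule F V) (Ra : R alpha) (i : 'I_(ncond alpha)) :
    i.+1 = ncond alpha ->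
    useq (uterm X Ra i (embed R X (ctgt i))) (embed R X (rhs alpha)).

Arguments useq {F V} R X _ _.

(* Main.v *)
(** The R-normal forms of a term s are U-reducts of s, hence they have a common
    U-reduct v.  Translating every U_i(w, vs) back to the instance of the
    left-hand side l that its arguments vs describe turns v into a term over F,
    and this term is each of the two normal forms, so they coincide.

    The point is that reducing an R-normal form n in U does not change its
    back-translation, i.e. that the rule U_k(t_k, X_k) -> r never applies.  This
    is shown by induction along the union of ->_U and the subterm relation.  If
    the i-th condition of a rule has been solved in U with matcher tau, an
    R-normal form n' of s_i sigma and t_i tau have a common U-reduct.  By
    right-stability t_i nf is U-irreducible, for nf the U-normal form of tau, so
    n' ->*_U t_i nf; as n' is smaller than n, n' is the back-translation of
    t_i nf.  So the condition is solved in R as well, with a matcher that is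
    joinable with tau.  If all the conditions are solved, then n is
    R-reducible. *)

From Stdlib Require Import Relation_Operators Classical ClassicalEpsilon.
Require Import Defs.
From mathcomp Require Import all_boot.

Set Implicit Arguments.
Unset Strict Implicit.
Unset Printing Implicit Defensive.

(** * Abstract rewriting *)

Section AbstractRewriting.

Variables (A : Type) (S : A -> A -> Prop).

Definition plus (x y : A) : Prop := exists2 m, S x m & star S m y.

Definition joinable (x y : A) : Prop := exists2 w, star S x w & star S y w.

Lemma plus_star x y : plus x y -> star S x y.
Proof. by case=> m Sxm; apply: rt_trans (rt_step _ _ _ _ Sxm). Qed.

Lemma star_plus x y z : star S x y -> plus y z -> plus x z.
Proof.
move/Operators_Properties.clos_rt_rt1n_iff=> Sxy Pyz.
elim: Sxy Pyz => // x1 y1 z1 Sxy _ IH /IH Pyz.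
by exists y1 => //; apply: plus_star.
Qed.

Lemma plus_star_trans x y z : plus x y -> star S y z -> plus x z.
Proof. by case=> m Sxm Smy Syz; exists m => //; apply: rt_trans Syz. Qed.

Lemma irreducible_star x y : irreducible S x -> star S x y -> y = x.
Proof.
move=> irr /Operators_Properties.clos_rt_rt1n_iff Sxy.
by case: Sxy irr => // y1 z1 Sxy _ []; exists y1.
Qed.

(** A non-accessible element has a non-accessible successor, so choosing successors repeatedly
    yields an infinite reduction. *)
Lemma terminating_wf : terminating S -> well_founded (fun y x => S x y).
Proof.
move=> SN x; apply: NNPP => nAx; apply: SN.
pose bad := {x : A | ~ Acc (fun y x => S x y) x}.
have next (b : bad) : {b' : bad | S (sval b) (sval b')}.
  apply: constructive_indefinite_description; case: b => y /= nAy.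
  apply: NNPP => noS; apply: nAy; constructor=> z Syz.
  by apply: NNPP => nAz; apply: noS; exists (exist _ z nAz).
pose u n := iter n (fun b => sval (next b)) (exist _ x nAx).
by exists (fun n => sval (u n)) => n; apply: svalP (next (u n)).
Qed.

Hypothesis wfS : well_founded (fun y x => S x y).

Lemma plus_ind (P : A -> Prop) :
  (forall x, (forall y, plus x y -> P y) -> P x) -> forall x, P x.
Proof.
move=> IHP x; suff: forall y, star S x y -> P y by apply; apply: rt_refl.
elim/(well_founded_ind wfS): x => x IH.
have IHp y : plus x y -> P y by case=> m Sxm; apply: IH.
move=> y /Operators_Properties.clos_rt_rt1n_iff Sxy.
case: Sxy => [|m z Sxm /Operators_Properties.clos_rt_rt1n_iff Smz].
  exact: IHP.
by apply: IHp; exists m.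
Qed.

Lemma normal_form_exists x : exists2 n, star S x n & irreducible S n.
Proof.
elim/(well_founded_ind wfS): x => x IH.
case: (classic (irreducible S x)) => [irr|/NNPP[y Sxy]].
  by exists x => //; apply: rt_refl.
have [n Syn irr] := IH y Sxy; exists n => //.
by apply: rt_trans (rt_step _ _ _ _ Sxy) Syn.
Qed.

Lemma joinable_sym x y : joinable x y -> joinable y x.
Proof. by case=> w; exists w. Qed.

Lemma star_joinable x y : star S x y -> joinable x y.
Proof. by move=> Sxy; exists y => //; apply: rt_refl. Qed.

Hypothesis confS : confluent S.

Lemma joinable_trans y x z : joinable x y -> joinable y z -> joinable x z.
Proof.
case=> w Sxw Syw [w' Syw' Szw'].
have [v [Swv Sw'v]] := confS Syw Syw'.
by exists v; [apply: rt_trans Swv | apply: rt_trans Sw'v].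
Qed.

Lemma joinable_irreducible x y :
  joinable x y -> irreducible S y -> star S x y.
Proof. by case=> w Sxw Syw irr; rewrite -(irreducible_star irr Syw). Qed.

End AbstractRewriting.

Lemma star_homo (A B : Type) (S : A -> A -> Prop) (S' : B -> B -> Prop)
    (h : A -> B) :
  (forall x y, S x y -> star S' (h x) (h y)) ->
  forall x y, star S x y -> star S' (h x) (h y).
Proof.
move=> hS x y; elim=> [u v|u|u v w _ Suv _ Svw]; [exact: hS|exact: rt_refl|].
exact: rt_trans Svw.
Qed.

(** * Terms and unconditional rewriting *)

Section Terms.

Variables (F : signature) (V : eqType).
Implicit Types (t : term F V) (sigma tau : V -> term F V).

Lemma vars_arg (f : F) (a : {ffun 'I_(arity f) -> term F V}) i x :
  x \in vars (a i) -> x \in vars (App f a).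
Proof.
by move=> xa; apply/flatten_mapP; exists i; rewrite ?mem_enum.
Qed.

Lemma ground_arg (f : F) (a : {ffun 'I_(arity f) -> term F V}) i :
  ground (App f a) -> ground (a i).
Proof.
move=> gr; rewrite /ground; case E: (vars (a i)) => [//|x s].
by have := @vars_arg f a i x; rewrite E gr mem_head => /(_ isT).
Qed.

Lemma eq_in_subst sigma tau t :
  {in vars t, sigma =1 tau} -> subst sigma t = subst tau t.
Proof.
elim: t => [x|f a IH] /= eq_st; first by apply: eq_st; rewrite inE.
congr App; apply/ffunP=> i; rewrite !ffunE.
by apply: IH => x xa; apply: eq_st; apply: vars_arg xa.
Qed.

Lemma set_argE (f : F) (a : {ffun 'I_(arity f) -> term F V}) i u j :
  set_arg a i u j = if j == i then u else a j.
Proof. by rewrite ffunE. Qed.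

Lemma subst_Var t : subst Var t = t.
Proof.
by elim: t => //= f a IH; congr App; apply/ffunP=> i; rewrite ffunE IH.
Qed.

Lemma subst_subst sigma tau t :
  subst tau (subst sigma t) = subst (fun x => subst tau (sigma x)) t.
Proof.
elim: t => //= f a IH; congr App; apply/ffunP=> i.
by rewrite !ffunE IH.
Qed.

Variable T : trs F V.

Lemma rstep_subst sigma t u :
  rstep T t u -> rstep T (subst sigma t) (subst sigma u).
Proof.
elim=> [l r tau Tlr|f a i v _ IH] /=.
  by rewrite !subst_subst; apply: rstep_root.
have -> : [ffun j => subst sigma (set_arg a i v j)] =
          set_arg [ffun j => subst sigma (a j)] i (subst sigma v).
  by apply/ffunP=> j; rewrite !ffunE; case: eqP.
by apply: rstep_arg; rewrite ffunE.
Qed.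

Lemma rstep_AppP (f : F) (a : {ffun 'I_(arity f) -> term F V}) u :
    rstep T (App f a) u ->
  (exists l r sigma, [/\ T l r, App f a = subst sigma l & u = subst sigma r])
  \/ exists i u', rstep T (a i) u' /\ u = App f (set_arg a i u').
Proof.
move=> Tau; pose t := App f a; rewrite -/t in Tau *.
(* The dependent type of [a] blocks inversion on [App f a]; a goal that matches on the abstracted
   term [t] avoids this. *)
have: match t return Prop with
      | Var _ => True
      | App g b =>
        (exists l r sigma, [/\ T l r, App g b = subst sigma l
                                    & u = subst sigma r])
        \/ exists i u', rstep T (b i) u' /\ u = App g (set_arg b i u')
      end; last by [].
case: Tau => [l r sigma Tlr|g b i u' Tb]; last by right; exists i, u'.
by case E: (subst sigma l) => [|g b] //; left; exists l, r, sigma; rewrite E.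
Qed.

Lemma star_set_arg (f : F) (a : {ffun 'I_(arity f) -> term F V}) i u :
  star (rstep T) (a i) u -> star (rstep T) (App f a) (App f (set_arg a i u)).
Proof.
have Ea : a = set_arg a i (a i).
  by apply/ffunP=> j; rewrite set_argE; case: eqP => // ->.
move=> Tau; rewrite [X in App f X]Ea; move: Tau.
apply: (star_homo (h := fun t => App f (set_arg a i t))) => t t' Ttt'.
apply: rt_step.
have -> : set_arg a i t' = set_arg (set_arg a i t) i t'.
  by apply/ffunP=> j; rewrite !set_argE; case: eqP.
by apply: rstep_arg; rewrite set_argE eqxx.
Qed.

Lemma star_App (f : F) (a b : {ffun 'I_(arity f) -> term F V}) :
  (forall i, star (rstep T) (a i) (b i)) ->
  star (rstep T) (App f a) (App f b).
Proof.
(* [c s] has the arguments in [s] already rewritten; the positions are treated one at a time along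
   the enumeration. *)
move=> Tab; pose c (s : seq 'I_(arity f)) : {ffun 'I_(arity f) -> term F V} :=
  [ffun i => if i \in s then b i else a i].
have -> : b = c (enum 'I_(arity f)).
  by apply/ffunP=> i; rewrite ffunE mem_enum.
elim: (enum _) => [|i s IH].
  rewrite (_ : c [::] = a); first exact: rt_refl.
  by apply/ffunP=> i; rewrite ffunE.
apply: rt_trans IH _.
have -> : c (i :: s) = set_arg (c s) i (b i).
  apply/ffunP=> j; rewrite set_argE !ffunE inE.
  by case: eqP => // ->.
apply: star_set_arg; rewrite ffunE; case: ifP => // _; exact: rt_refl.
Qed.

Lemma joinable_App (f : F) (a b : {ffun 'I_(arity f) -> term F V}) :
  (forall i, joinable (rstep T) (a i) (b i)) ->
  joinable (rstep T) (App f a) (App f b).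
Proof.
move=> Jab.
have /fin_all_exists[c Tc] i :
    exists w, star (rstep T) (a i) w /\ star (rstep T) (b i) w.
  by have [w] := Jab i; exists w.
by exists (App f (finfun c)); apply: star_App => i; rewrite ffunE; case: (Tc i).
Qed.

Lemma star_subst sigma tau t :
  (forall x, x \in vars t -> star (rstep T) (sigma x) (tau x)) ->
  star (rstep T) (subst sigma t) (subst tau t).
Proof.
elim: t => [x|f a IH] /= st; first by apply: st; rewrite inE.
apply: star_App => i; rewrite !ffunE; apply: IH => x xa.
by apply: st; apply: vars_arg xa.
Qed.

Lemma joinable_subst sigma tau t :
  (forall x, x \in vars t -> joinable (rstep T) (sigma x) (tau x)) ->
  joinable (rstep T) (subst sigma t) (subst tau t).
Proof.
elim: t => [x|f a IH] /= st; first by apply: st; rewrite inE.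
apply: joinable_App => i; rewrite !ffunE; apply: IH => x xa.
by apply: st; apply: vars_arg xa.
Qed.

Definition subterm_or_step t u : Prop :=
  rstep T t u \/ exists f (a : {ffun 'I_(arity f) -> term F V}) i,
    t = App f a /\ u = a i.

Lemma subterm_or_step_wf :
  well_founded (fun u t => rstep T t u) ->
  well_founded (fun u t => subterm_or_step t u).
Proof.
move=> wfT t; elim/(well_founded_ind wfT): t => t.
(* A step inside an immediate subterm lifts to the whole term, so accessibility
   of the reducts is inherited by subterms. *)
elim: t => [x|f a IHa] IHt; constructor=> u [/IHt //|[g [b [i [E ->]]]]].
  by [].
have {g b i E} [j ->] : exists j, b i = a j.
  pose is_arg t := match t return Prop with
                   | Var _ => True
                   | App h c => exists j : 'I_(arity h), b i = c j
                   end.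
  by suff: is_arg (App f a) by []; rewrite E; exists i.
apply: IHa => v Tav.
have /IHt Acc_v := rstep_arg Tav.
apply: (Acc_inv Acc_v); right; exists f, (set_arg a j v), j.
by rewrite set_argE eqxx.
Qed.

Lemma star_subterm sigma t x :
  x \in vars t -> star subterm_or_step (subst sigma t) (sigma x).
Proof.
elim: t => [y|f a IH] /=; first by rewrite inE => /eqP->; apply: rt_refl.
case/flatten_mapP=> i _ /IH; apply: rt_trans; apply: rt_step; right.
by exists f, [ffun j => subst sigma (a j)], i; rewrite ffunE.
Qed.

Lemma star_step_subterm t u :
  star (rstep T) t u -> star subterm_or_step t u.
Proof.
by apply: (star_homo (h := id)) => x y Txy; apply: rt_step; left.
Qed.

Lemma rstep_sub_T (T' : trs F V) :
  (forall l r, T l r -> T' l r) -> forall t u, rstep T t u -> rstep T' t u.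
Proof.
move=> TT' t u; elim=> [l r sigma /TT'|f a i v _]; first exact: rstep_root.
exact: rstep_arg.
Qed.

End Terms.

(** * Conditional rewriting *)

Section ConditionalSystem.

Variables (F : signature) (V : eqType) (R : ctrs F V).
Implicit Types (alpha : crule F V) (sigma : V -> term F V).

Lemma cstep_arg (f : F) (a : {ffun 'I_(arity f) -> term F V}) i u :
  cstep R (a i) u -> cstep R (App f a) (App f (set_arg a i u)).
Proof. by case=> n Ra; exists n; apply: rstep_arg. Qed.

Lemma irreducible_arg (f : F) (a : {ffun 'I_(arity f) -> term F V}) i :
  irreducible (cstep R) (App f a) -> irreducible (cstep R) (a i).
Proof.
by move=> irr [u /cstep_arg Rau]; apply: irr; exists (App f (set_arg a i u)).
Qed.

Lemma irreducible_subst sigma t x :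
  x \in vars t -> irreducible (cstep R) (subst sigma t) ->
  irreducible (cstep R) (sigma x).
Proof.
elim: t => [y|f a IH] /=; first by rewrite inE => /eqP->.
case/flatten_mapP=> i _ /IH IHi irr; apply: IHi.
by have := irreducible_arg (i := i) irr; rewrite ffunE.
Qed.

Lemma level_leq m n l r : m <= n -> level R m l r -> level R n l r.
Proof.
elim: m n l r => // m IH [|n] l r //= le_mn [alpha [sigma [Ra -> -> Hc]]].
exists alpha, sigma; split=> // j.
apply: (star_homo (h := id)) (Hc j) => u v Luv; apply: rt_step.
by apply: rstep_sub_T Luv => l' r'; apply: IH.
Qed.

Lemma star_cstep_level t u :
  star (cstep R) t u -> exists n, star (rstep (level R n)) t u.
Proof.
elim=> [x y [n Rxy]|x|x y z _ [m Rxy] _ [n Ryz]].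
- by exists n; apply: rt_step.
- by exists 0; apply: rt_refl.
exists (maxn m n); have lift k t' u' : k <= maxn m n ->
    star (rstep (level R k)) t' u' -> star (rstep (level R (maxn m n))) t' u'.
  move=> le_k; apply: (star_homo (h := id)) => a b Lab; apply: rt_step.
  by apply: rstep_sub_T Lab => l r; apply: level_leq.
by apply: (@rt_trans _ _ _ y); [apply: lift Rxy | apply: lift Ryz];
  rewrite ?leq_maxl ?leq_maxr.
Qed.

Lemma cstep_root alpha sigma :
  R alpha ->
  (forall j : 'I_(ncond alpha),
     star (cstep R) (subst sigma (csrc j)) (subst sigma (ctgt j))) ->
  cstep R (subst sigma (lhs alpha)) (subst sigma (rhs alpha)).
Proof.
move=> Ra Hc.
have /fin_all_exists[n Hn] j := star_cstep_level (Hc j).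
(* The finitely many conditions all hold at the maximum of their levels; the rule instance belongs
   to the next level. *)
exists (\max_j n j).+1.
(* [level] already consists of instances, so the root step uses the identity substitution. *)
rewrite -[subst _ (lhs _)]subst_Var -[subst _ (rhs _)]subst_Var.
apply: rstep_root; exists alpha, sigma; split=> // j.
apply: (star_homo (h := id)) (Hn j) => u v Luv; apply: rt_step.
apply: rstep_sub_T Luv => l r; apply: level_leq; exact: leq_bigmax.
Qed.

End ConditionalSystem.

Lemma mem_flatten_map (A : Type) (V : eqType) (f : A -> seq V) (s : seq A) x :
  (x \in flatten [seq f c | c <- s]) = has (fun c => x \in f c) s.
Proof. by elim: s => //= c s IH; rewrite mem_cat IH. Qed.

Section RuleVariables.

Variables (F : signature) (V : eqType) (alpha : crule F V).

Lemma mem_lt_varsS (i : 'I_(ncond alpha)) x :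
  (x \in lt_vars alpha i.+1) = (x \in lt_vars alpha i) || (x \in vars (ctgt i)).
Proof.
rewrite /ctgt (tnth_nth (tnth (in_tuple (conds alpha)) i)) /lt_vars.
rewrite (take_nth (tnth (in_tuple (conds alpha)) i)); last exact: (ltn_ord i).
by rewrite -cats1 map_cat flatten_cat /= cats0 !mem_cat -!orbA.
Qed.

Lemma lhs_lt_vars i : {subset vars (lhs alpha) <= lt_vars alpha i}.
Proof. by move=> x xl; rewrite mem_cat xl. Qed.

Lemma lt_vars_leq i j : i <= j -> {subset lt_vars alpha i <= lt_vars alpha j}.
Proof.
move=> le_ij x; rewrite !mem_cat !mem_flatten_map => /orP[->//|x_i].
rewrite -(cat_take_drop i (take j _)) has_cat take_takel //.
by rewrite x_i orbT.
Qed.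

Lemma lt_vars_lst i : {subset lt_vars alpha i <= lst_vars alpha i}.
Proof.
move=> x; rewrite !mem_cat !mem_flatten_map => /orP[->//|x_i].
apply/orP; right; apply: sub_has x_i => c; rewrite mem_cat => ->.
exact: orbT.
Qed.

End RuleVariables.

(** * The unraveled system *)

Section Unraveling.

Variables (F : signature) (V : eqType) (R : ctrs F V) (X : var_seqs F V).
Implicit Types (alpha : crule F V) (t : term F V) (v : term (ext_sig R X) V).

Local Notation U := (rstep (useq R X)).
Local Notation emb := (embed R X).

Lemma embed_subst sigma t :
  emb (subst sigma t) = subst (fun x => emb (sigma x)) (emb t).
Proof.
by elim: t => //= f a IH; congr App; apply/ffunP=> i; rewrite !ffunE IH.
Qed.

Lemma vars_embed t : vars (emb t) = vars t.
Proof.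
by elim: t => //= f a IH; congr flatten; apply: eq_map => i; rewrite ffunE IH.
Qed.

Lemma embed_set_arg (f : F) (a : {ffun 'I_(arity f) -> term F V}) i u :
  emb (App f (set_arg a i u)) =
  @App (ext_sig R X) V (inl f)
    (@set_arg (ext_sig R X) V (inl f) [ffun j => emb (a j)] i (emb u)).
Proof.
by congr App; apply/ffunP=> j; rewrite !ffunE; case: eqP.
Qed.

(** * Argument positions of the fresh symbols *)

Hypothesis X_orders : orders_vars R X.

(* Argument 0 is the condition in progress; the junk value for [x] outside the
   variable sequence is irrelevant. *)
Definition uarg (u : usym R) (x : V) : 'I_(size (X (uindex u))).+1 :=
  inord (index x (X (uindex u))).+1.

Lemma uarg_lt (u : usym R) x :
  x \in lt_vars (urule u) (uindex u) -> x \in X (uindex u).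
Proof. by case: (X_orders (urule_in u) (uindex u)) => _ ->. Qed.

Lemma uargP (u : usym R) (j : 'I_(size (X (uindex u))).+1) :
  j = ord0 \/ exists2 x, x \in lt_vars (urule u) (uindex u) & j = uarg u x.
Proof.
have [Xuniq memX] := X_orders (urule_in u) (uindex u).
case: (unliftP ord0 j) => [k ->|->]; [right | by left].
exists (tnth (in_tuple (X (uindex u))) k); first by rewrite -memX mem_tnth.
apply: val_inj; rewrite /= inordK; last by rewrite ltnS index_mem mem_tnth.
rewrite (tnth_nth (tnth (in_tuple (X (uindex u))) k)) /= index_uniq //.
Qed.

Definition uargs alpha (Ra : R alpha) (i : 'I_(ncond alpha)) v :
    {ffun 'I_(size (X i)).+1 -> term (ext_sig R X) V} :=
  [ffun j => tnth [tuple of v :: map Var (in_tuple (X i))] j].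

Lemma uargs0 alpha (Ra : R alpha) (i : 'I_(ncond alpha)) v :
  @uargs alpha Ra i v ord0 = v.
Proof. by rewrite ffunE. Qed.

Lemma uargs_uarg alpha (Ra : R alpha) (i : 'I_(ncond alpha)) v x :
  x \in lt_vars alpha i -> @uargs alpha Ra i v (uarg (USym Ra i) x) = Var x.
Proof.
move=> xi; have xX := @uarg_lt (USym Ra i) x xi.
rewrite ffunE (tnth_nth (Var x)) /= inordK ?ltnS ?index_mem //=.
by rewrite (nth_map x) ?index_mem // nth_index.
Qed.

Lemma subst_uterm tau alpha (Ra : R alpha) i v :
  subst tau (uterm X Ra i v) =
  @App (ext_sig R X) V (inr (USym Ra i)) [ffun j => subst tau (uargs Ra i v j)].
Proof. by []. Qed.

Lemma joinable_uterm (tau : V -> term (ext_sig R X) V)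
    (u : usym R)
    (a : {ffun 'I_(size (X (uindex u))).+1 -> term (ext_sig R X) V}) v :
  joinable U (a ord0) (subst tau v) ->
  (forall x, x \in lt_vars (urule u) (uindex u) ->
     joinable U (a (uarg u x)) (tau x)) ->
  joinable U (@App (ext_sig R X) V (inr u) a)
             (subst tau (uterm X (urule_in u) (uindex u) v)).
Proof.
case: u a => alpha Ra i a J0 Jx; rewrite subst_uterm; apply: joinable_App => j.
rewrite ffunE; case: (@uargP (USym Ra i) j) => [->|[x xi ->]].
  by rewrite uargs0.
by rewrite uargs_uarg //=; apply: Jx.
Qed.

(** * Simulation of conditional steps in the unraveled system *)

Lemma star_uterm tau alpha (Ra : R alpha) i v w :
  star U (subst tau v) (subst tau w) ->
  star U (subst tau (uterm X Ra i v)) (subst tau (uterm X Ra i w)).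
Proof.
move=> Uvw; apply: star_App => j.
rewrite !ffunE; case: (unliftP ord0 j) => [k ->|->].
  by rewrite !tnthS; apply: rt_refl.
by rewrite !tnth0.
Qed.

(** Solving a condition turns the first argument from [csrc] into [ctgt], whereupon the rule leading
    to the next condition applies. The initial step makes the reduction nonempty, as the
    well-founded inductions require. *)
Lemma conditions_plus alpha (Ra : R alpha) sigma (i : 'I_(ncond alpha)) :
  (forall j : 'I_(ncond alpha), j < i ->
     star U (emb (subst sigma (csrc j))) (emb (subst sigma (ctgt j)))) ->
  plus U (emb (subst sigma (lhs alpha)))
    (subst (fun x => emb (sigma x)) (uterm X Ra i (emb (csrc i)))).
Proof.
case: i => n; elim: n => [|n IH] lt_n Hc.
  eexists; last exact: rt_refl.
  by rewrite embed_subst; apply: rstep_root; apply: useq_first.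
have lt_n' := ltnW lt_n.
apply: plus_star_trans (IH lt_n' _) _.
  by move=> j ltj; apply: Hc; apply: ltnW.
have := Hc (Ordinal lt_n') (ltnSn n); rewrite !embed_subst => Hn.
apply: rt_trans (star_uterm _ _ Hn) (rt_step _ _ _ _ _).
by apply: rstep_root; apply: useq_next.
Qed.

Lemma rule_plus alpha (Ra : R alpha) sigma :
  (forall j : 'I_(ncond alpha),
     star U (emb (subst sigma (csrc j))) (emb (subst sigma (ctgt j)))) ->
  plus U (emb (subst sigma (lhs alpha))) (emb (subst sigma (rhs alpha))).
Proof.
move=> Hc; case: (posnP (ncond alpha)) => [n0|n_gt0].
  exists (emb (subst sigma (rhs alpha))); last exact: rt_refl.
  by rewrite !embed_subst; apply: rstep_root; apply: useq_uncond.
have lt_n : (ncond alpha).-1 < ncond alpha by rewrite prednK.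
apply: plus_star_trans (conditions_plus Ra (i := Ordinal lt_n) _) _ => //.
have := Hc (Ordinal lt_n); rewrite !embed_subst => Hn.
apply: rt_trans (star_uterm _ _ Hn) (rt_step _ _ _ _ _).
by apply: rstep_root; apply: useq_last; rewrite /= prednK.
Qed.

Lemma plus_embed_arg (f : F) (a : {ffun 'I_(arity f) -> term F V}) i u :
  plus U (emb (a i)) (emb u) ->
  plus U (emb (App f a)) (emb (App f (set_arg a i u))).
Proof.
case=> w Uaw Uwu; rewrite embed_set_arg.
pose g : ext_sig R X := inl f.
pose b : {ffun 'I_(arity g) -> term (ext_sig R X) V} := [ffun j => emb (a j)].
exists (App g (set_arg b i w)).
  by apply: rstep_arg; rewrite ffunE.
have -> : set_arg (f := g) b i (emb u) = set_arg (set_arg b i w) i (emb u).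
  by apply/ffunP=> j; rewrite !set_argE; case: eqP.
by apply: star_set_arg; rewrite set_argE eqxx.
Qed.

(** By induction on the level: the conditions hold one level lower and are thus simulated, so
    [rule_plus] simulates the rule. *)
Lemma level_plus n t u : rstep (level R n) t u -> plus U (emb t) (emb u).
Proof.
elim: n t u => [|n IHn] t u; elim=> [l r tau|f a i v _] //;
  try exact: plus_embed_arg.
case=> alpha [sigma [Ra -> -> Hc]].
have Hc' (j : 'I_(ncond alpha)) :
    star U (emb (subst sigma (csrc j))) (emb (subst sigma (ctgt j))).
  by apply: star_homo (Hc j) => t' u' /IHn; apply: plus_star.
rewrite !(embed_subst tau); have [m Um Us] := rule_plus Ra Hc'.
exists (subst (fun x => emb (tau x)) m); first exact: rstep_subst.
by apply: (star_homo _ Us) => t' u' Utu; apply: rt_step; apply: rstep_subst.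
Qed.

Lemma cstep_plus t u : cstep R t u -> plus U (emb t) (emb u).
Proof. by case=> n; apply: level_plus. Qed.

Lemma star_cstep_embed t u : star (cstep R) t u -> star U (emb t) (emb u).
Proof. by apply: star_homo => t' u' /cstep_plus; apply: plus_star. Qed.

(** * Back-translation and its invariant *)

Fixpoint backtr v : term F V :=
  match v with
  | Var x => Var x
  | App g a =>
    match g return {ffun 'I_(@arity (ext_sig R X) g) -> _} -> term F V with
    | inl f => fun a => App f [ffun i => backtr (a i)]
    | inr u => fun a => subst (fun x => backtr (a (uarg u x))) (lhs (urule u))
    end a
  end.

(* The substitution sigma witnesses that the conditions before the current one
   hold in R.  Since joinability is all that is required of the variables
   outside the left-hand side and of the condition in progress, U-steps there
   are harmless. *)
Fixpoint valid v : Prop :=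
  match v with
  | Var x => True
  | App g a =>
    match g return {ffun 'I_(@arity (ext_sig R X) g) -> _} -> Prop with
    | inl f => fun a => forall i, valid (a i)
    | inr u => fun a =>
      {in vars (lhs (urule u)), forall x, valid (a (uarg u x))} /\
      exists sigma : V -> term F V,
      [/\ {in vars (lhs (urule u)), forall x, sigma x = backtr (a (uarg u x))},
          {in lt_vars (urule u) (uindex u), forall x,
             joinable U (a (uarg u x)) (emb (sigma x))},
          forall j : 'I_(ncond (urule u)), j < uindex u ->
            star (cstep R) (subst sigma (csrc j)) (subst sigma (ctgt j))
        & joinable U (a ord0) (emb (subst sigma (csrc (uindex u))))]
    end a
  end.

Lemma backtr_subst tau t :
  backtr (subst tau (emb t)) = subst (fun x => backtr (tau x)) t.
Proof.
by elim: t => //= f a IH; congr App; apply/ffunP=> i; rewrite !ffunE IH.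
Qed.

(** An unfinished rule application stands for its redex. The index [i], the condition in progress
    and the bindings outside the left-hand side are forgotten, so moving on to the next condition
    leaves the back-translation fixed. *)
Lemma backtr_uterm tau alpha (Ra : R alpha) (i : 'I_(ncond alpha)) v :
  backtr (subst tau (uterm X Ra i v)) =
  subst (fun x => backtr (tau x)) (lhs alpha).
Proof.
rewrite subst_uterm /=; apply: eq_in_subst => x xl.
by rewrite ffunE uargs_uarg //; apply: lhs_lt_vars.
Qed.

Lemma valid_uterm tau alpha (Ra : R alpha) (i : 'I_(ncond alpha)) v :
  valid (subst tau (uterm X Ra i v)) <->
  {in vars (lhs alpha), forall x, valid (tau x)} /\
  exists sigma : V -> term F V,
  [/\ {in vars (lhs alpha), forall x, sigma x = backtr (tau x)},
      {in lt_vars alpha i, forall x, joinable U (tau x) (emb (sigma x))},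
      forall j : 'I_(ncond alpha), j < i ->
        star (cstep R) (subst sigma (csrc j)) (subst sigma (ctgt j))
    & joinable U (subst tau v) (emb (subst sigma (csrc i)))].
Proof.
have Ea x : x \in lt_vars alpha i ->
    [ffun j => subst tau (uargs Ra i v j)] (uarg (USym Ra i) x) = tau x.
  by move=> xi; rewrite ffunE uargs_uarg.
have El x : x \in vars (lhs alpha) ->
    [ffun j => subst tau (uargs Ra i v j)] (uarg (USym Ra i) x) = tau x.
  by move=> xl; apply: Ea; apply: lhs_lt_vars.
have E0 : [ffun j => subst tau (uargs Ra i v j)] ord0 = subst tau v.
  by rewrite ffunE uargs0.
rewrite subst_uterm /= E0.
split=> -[vl [sigma [Hl Hi Hc H0]]];
  (split; last (exists sigma; split=> //)) => x xV.
- by rewrite -El //; apply: vl.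
- by rewrite -El //; apply: Hl.
- by rewrite -Ea //; apply: Hi.
- by rewrite El //; apply: vl.
- by rewrite El //; apply: Hl.
- by rewrite Ea //; apply: Hi.
Qed.

Lemma backtr_embed t : backtr (emb t) = t.
Proof. by rewrite -[emb t]subst_Var backtr_subst /= subst_Var. Qed.

Lemma valid_subst tau t :
  valid (subst tau (emb t)) <-> {in vars t, forall x, valid (tau x)}.
Proof.
elim: t => [x|f a IH] /=.
  by split=> [vx y|]; [rewrite inE => /eqP-> | apply; rewrite inE].
split=> [va x /flatten_mapP[i _]|va i].
  by apply: (IH i).1; have := va i; rewrite !ffunE.
rewrite !ffunE; apply/IH => x xa; apply: va; apply/flatten_mapP.
by exists i; rewrite ?mem_enum.
Qed.

Lemma valid_embed t : valid (emb t).
Proof. by rewrite -[emb t]subst_Var; apply/valid_subst. Qed.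

(** * Irreducibility of the condition targets *)

Hypothesis R_dctrs : dctrs R.
Hypothesis R_stable : right_stable R.
Hypothesis U_confluent : confluent U.
Hypothesis U_terminating : terminating U.

Let U_wf : well_founded (fun w v => U v w) := terminating_wf U_terminating.
Let joinU_trans := @joinable_trans _ U U_confluent.

(** A variable as left-hand side would make every term U-reducible, but termination provides normal
    forms. *)
Lemma lhs_not_var alpha x : R alpha -> lhs alpha <> Var x.
Proof.
move=> Ra El.
have [n _ irr] := normal_form_exists U_wf (Var x).
apply: irr; have rootx r : useq R X (emb (lhs alpha)) r ->
    U n (subst (fun _ => n) r).
  by move=> /rstep_root-/(_ (fun _ => n)); rewrite El.
case: (posnP (ncond alpha)) => [n0|n_gt0].
  by eexists; apply: rootx; apply: useq_uncond.
eexists; apply: rootx; exact: (@useq_first _ _ _ _ _ Ra (Ordinal n_gt0)).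
Qed.

Lemma root_lhs l r sigma (f : F) a :
  useq R X l r -> @App (ext_sig R X) V (inl f) a = subst sigma l ->
  exists2 alpha, R alpha & l = emb (lhs alpha).
Proof. by case=> // alpha; exists alpha. Qed.

(** By [lhs_not_var], a step at a function symbol of [t] would make that symbol defined. *)
Lemma constructor_irreducible tau t :
  constructor_term R t -> {in vars t, forall x, irreducible U (tau x)} ->
  irreducible U (subst tau (emb t)).
Proof.
elim: t => [x|f a IH] cons irr [w].
  by move=> Uw; apply: (irr x); [rewrite inE | exists w].
case/rstep_AppP=> [[l [r [sigma [Ulr El _]]]]|[i [w' [+ _]]]].
  have [alpha Ra El'] := root_lhs Ulr El.
  apply: (cons f); first by left.
  rewrite El' in El; case El2: (lhs alpha) El => [x|g b].
    by case: (lhs_not_var Ra El2).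
  case=> Efg _; rewrite Efg; exists alpha, b; split=> //.
rewrite !ffunE => Uw'; apply: (IH i); last by exists w'.
  by move=> g ag; apply: cons; right; exists i.
by move=> x xa; apply: irr; apply: vars_arg xa.
Qed.

Lemma ground_irreducible tau t :
  ground t -> irreducible (rstep (underlying R)) t ->
  irreducible U (subst tau (emb t)).
Proof.
elim: t => [//|f a IH] gr irr [w].
case/rstep_AppP=> [[l [r [sigma [Ulr El _]]]]|[i [w' [+ _]]]].
  have [alpha Ra El'] := root_lhs Ulr El; subst l.
  (* Back-translating the matcher turns a U-redex at the root into an instance of [lhs alpha], a
     redex of the underlying system because conditions are dropped there. *)
  have Et : App f a = subst (fun x => backtr (sigma x)) (lhs alpha).
    rewrite -backtr_subst -El.
    change (App f a = backtr (subst tau (emb (App f a)))).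
    rewrite backtr_subst -[LHS]subst_Var; apply: eq_in_subst => x.
    by rewrite gr.
  apply: irr; rewrite Et; eexists; apply: rstep_root; by exists alpha.
rewrite !ffunE => Uw'; apply: (IH i); last by exists w'.
  exact: ground_arg gr.
case=> u Tau; apply: irr; exists (App f (set_arg a i u)); exact: rstep_arg.
Qed.

Lemma ctgt_irreducible alpha (i : 'I_(ncond alpha)) tau :
  R alpha -> {in vars (ctgt i), forall x, irreducible U (tau x)} ->
  irreducible U (subst tau (emb (ctgt i))).
Proof.
move=> Ra irr; case: (R_stable Ra i) => [[[_ cons]|[gr irr_t]] _].
  exact: constructor_irreducible.
exact: ground_irreducible.
Qed.

(** The conditions solved so far lead in U from the back-translation to a term with the same
    U-symbol at the root, and [valid] makes the arguments pairwise joinable. *)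
Lemma valid_joinable v : valid v -> joinable U v (emb (backtr v)).
Proof.
elim: v => [x|[f|u] a IH] /=; first by move=> _; apply/star_joinable/rt_refl.
  move=> va; apply: joinable_App => i; rewrite !ffunE; exact: IH.
case=> _ [sigma [Esigma Jsigma Hc J0]].
rewrite -(eq_in_subst Esigma).
have P := conditions_plus (urule_in u)
  (fun j ltj => star_cstep_embed (Hc j ltj)).
apply: joinU_trans (joinable_sym (star_joinable (plus_star P))).
by apply: joinable_uterm => //; rewrite -embed_subst.
Qed.

(** Termination carries over, since each step of [R] is simulated by at least one step of U. *)
Lemma cstep_normal_form t :
  exists2 n, star (cstep R) t n & irreducible (cstep R) n.
Proof.
move Ev: (emb t) => v; elim/(plus_ind U_wf): v t Ev => v IH t Ev.
case: (classic (irreducible (cstep R) t)) => [irr|/NNPP[u Rtu]].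
  by exists t => //; apply: rt_refl.
have [|n Run irr] := IH (emb u) _ u erefl.
  by rewrite -Ev; apply: cstep_plus.
by exists n => //; apply: rt_trans (rt_step _ _ _ _ Rtu) Run.
Qed.

(** * Preservation of the back-translation under U-steps *)

Definition faithful (n : term F V) : Prop :=
  forall v, star U (emb n) v -> valid v /\ backtr v = n.

Local Notation below := (plus (subterm_or_step (useq R X))).

(** The induction hypothesis of [irreducible_faithful], in the form used to analyse single steps. *)
Definition faithful_below t : Prop :=
  forall n, irreducible (cstep R) n -> below (emb t) (emb n) -> faithful n.

(** The matcher is redefined only on the variables of [ctgt i]; right-stability makes these new, so
    the earlier conditions stay solved. *)
Lemma condition_solved alpha (Ra : R alpha) (i : 'I_(ncond alpha)) sigma tau :
  {in lt_vars alpha i, forall x, joinable U (tau x) (emb (sigma x))} ->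
  (forall j : 'I_(ncond alpha), j < i ->
     star (cstep R) (subst sigma (csrc j)) (subst sigma (ctgt j))) ->
  joinable U (subst tau (emb (ctgt i))) (emb (subst sigma (csrc i))) ->
  faithful_below (subst sigma (lhs alpha)) ->
  exists sigma',
  [/\ {in lt_vars alpha i, sigma' =1 sigma},
      {in lt_vars alpha i.+1, forall x, joinable U (tau x) (emb (sigma' x))}
    & forall j : 'I_(ncond alpha), j < i.+1 ->
        star (cstep R) (subst sigma' (csrc j)) (subst sigma' (ctgt j))].
Proof.
move=> Jsigma Hc J0 faith.
have /choice[nf Hnf] x : exists w, star U (tau x) w /\ irreducible U w.
  by have [w] := normal_form_exists U_wf (tau x); exists w.
have [n Rn irr] := cstep_normal_form (subst sigma (csrc i)).
(* The two terms are joinable via [subst sigma (csrc i)] and [subst tau (emb (ctgt i))]; as the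
   second is irreducible, joinability becomes a reduction. *)
have Un : star U (emb n) (subst nf (emb (ctgt i))).
  apply: (joinable_irreducible _); last first.
    by apply: ctgt_irreducible => // x _; case: (Hnf x).
  have Unf : star U (subst tau (emb (ctgt i))) (subst nf (emb (ctgt i))).
    by apply: star_subst => x _; case: (Hnf x).
  apply: joinU_trans (star_joinable Unf); apply: joinU_trans (joinable_sym J0).
  exact/joinable_sym/star_joinable/star_cstep_embed.
(* The simulation reaches a U-term whose first argument is the instance of [csrc i], which rewrites
   to [n]; its initial step makes the descent strict. *)
have below_n : below (emb (subst sigma (lhs alpha))) (emb n).
  have [m Um Us] := conditions_plus Ra
    (fun j ltj => star_cstep_embed (Hc j ltj)).
  exists m; first by left.
  apply: rt_trans (star_step_subterm Us) _.
  apply: (@rt_trans _ _ _ (emb (subst sigma (csrc i)))); last first.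
    exact/star_step_subterm/star_cstep_embed.
  apply: rt_step; right; rewrite subst_uterm.
  exists (inr (USym Ra i) : ext_sig R X); eexists.
  exists (ord0 : 'I_(size (X i)).+1); split; first by [].
  by rewrite !ffunE embed_subst.
have [valid_t En] := faith n irr below_n _ Un.
rewrite backtr_subst in En; move/valid_subst: valid_t; move=> valid_nf.
pose sigma' x := if x \in vars (ctgt i) then backtr (nf x) else sigma x.
have fresh : {in lt_vars alpha i, sigma' =1 sigma}.
  move=> x xi; rewrite /sigma'; case: ifP => // xt.
  have [_ /(_ x xt)] := R_stable Ra i.
  by rewrite mem_cat (lt_vars_lst xi).
have [_ det] := R_dctrs Ra.
exists sigma'; split=> // [x|j].
  rewrite mem_lt_varsS; case xt: (x \in vars (ctgt i)) => /=.
    move=> _; rewrite /sigma' xt; have [Ux _] := Hnf x.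
    exact: joinU_trans (star_joinable Ux) (valid_joinable (valid_nf x xt)).
  by rewrite orbF => xi; rewrite fresh //; apply: Jsigma.
rewrite ltnS => le_ji.
rewrite (@eq_in_subst _ _ sigma' sigma (csrc j)); last first.
  by move=> x /det xj; apply: fresh; apply: lt_vars_leq xj.
case: (ltngtP j i) le_ji => // [lt_ji|Eji] _.
  rewrite (@eq_in_subst _ _ sigma' sigma); first exact: Hc.
  move=> x xj; apply: fresh.
  by apply: (lt_vars_leq lt_ji); rewrite mem_lt_varsS xj orbT.
(* For the newly solved condition, the instance of [csrc i] rewrites to [n], which by [En] is the
   instance of [ctgt i]. *)
have {j Eji}-> : j = i by apply: val_inj.
rewrite (@eq_in_subst _ _ sigma' (fun x => backtr (nf x))) ?En //.
by move=> x xt; rewrite /sigma' xt.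
Qed.

Lemma faithful_below_star t u :
  star (subterm_or_step (useq R X)) (emb t) (emb u) ->
  faithful_below t -> faithful_below u.
Proof. by move=> Stu ft n irr /(star_plus Stu); apply: ft. Qed.

Lemma valid_step_root l r tau :
  useq R X l r -> valid (subst tau l) ->
  irreducible (cstep R) (backtr (subst tau l)) ->
  faithful_below (backtr (subst tau l)) ->
  valid (subst tau r) /\ backtr (subst tau r) = backtr (subst tau l).
Proof.
case=> {l r} [alpha Ra n0|alpha Ra i i0|alpha Ra i j Eij|alpha Ra i Ei].
(* An unconditional rule would reduce the back-translation in [R]. *)
- rewrite backtr_subst => _ irr _; case: irr; eexists; apply: cstep_root => //.
  by move=> j; have := ltn_ord j; rewrite {2}n0.
(* No condition is solved yet and [lt_vars] has only the variables of the left-hand side, so the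
   back-translated matcher is a witness. *)
- move=> /valid_subst; rewrite backtr_uterm backtr_subst => vl _ _.
  have lti x : x \in lt_vars alpha i -> x \in vars (lhs alpha).
    by rewrite i0 /lt_vars take0 cats0.
  have Jl x : x \in vars (lhs alpha) ->
      joinable U (tau x) (emb (backtr (tau x))).
    by move=> /vl; apply: valid_joinable.
  split=> //; apply/valid_uterm; split=> //; exists (fun x => backtr (tau x)).
  split=> // [x /lti|j|]; [exact: Jl | by rewrite i0 |].
  rewrite embed_subst; apply: joinable_subst => x.
  by rewrite vars_embed => /(proj2 (R_dctrs Ra) i) /lti; apply: Jl.
(* The condition in progress is solved, and [condition_solved] supplies the witness for the next
   one. *)
- move=> /valid_uterm[vl [sigma [Hl Hi Hc H0]]].
  rewrite !backtr_uterm -(eq_in_subst Hl) => _ faith.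
  have [sigma' [Es Hi' Hc']] := condition_solved Ra Hi Hc H0 faith.
  split=> //; apply/valid_uterm; split=> //; exists sigma'; rewrite Eij.
  split=> // [x xl|]; first by rewrite -Hl // Es //; apply: lhs_lt_vars.
  rewrite embed_subst; apply: joinable_subst => x.
  by rewrite vars_embed => /(proj2 (R_dctrs Ra) j); rewrite Eij; apply: Hi'.
(* With the last condition solved, the redex is reducible in [R], so this case cannot arise. *)
move=> /valid_uterm[vl [sigma [Hl Hi Hc H0]]].
rewrite !backtr_uterm -(eq_in_subst Hl) => irr faith.
have [sigma' [Es _ Hc']] := condition_solved Ra Hi Hc H0 faith.
case: irr; rewrite -(@eq_in_subst _ _ sigma') => [|x xl]; last first.
  by rewrite Es //; apply: lhs_lt_vars.
eexists; apply: cstep_root => // j; apply: Hc'.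
by rewrite Ei.
Qed.

Lemma valid_step v w :
  U v w -> valid v -> irreducible (cstep R) (backtr v) ->
  faithful_below (backtr v) -> valid w /\ backtr w = backtr v.
Proof.
elim=> [l r tau|]; first exact: valid_step_root.
case=> [f|u] a i w' Uaw IH /=.
  move=> va irr faith; have [||vw' Ew'] := IH (va i).
  - by have := @irreducible_arg _ _ _ f _ i irr; rewrite ffunE.
  - apply: faithful_below_star faith; apply: rt_step; right.
    exists (inl f : ext_sig R X); eexists; exists i.
    by split; rewrite // !ffunE.
  split=> [j|]; first by rewrite ffunE; case: eqP.
  by congr App; apply/ffunP=> j; rewrite !ffunE; case: eqP => // ->.
move=> [vl [sigma [Hl Hi Hc H0]]] irr faith.
(* At a left-hand side variable the back-translated argument is a subterm of the whole
   back-translation, hence irreducible and covered by [faith]. At other arguments only joinability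
   has to survive the step. *)
have IHl x : x \in vars (lhs (urule u)) -> uarg u x = i ->
    valid w' /\ backtr w' = backtr (a i).
  move=> xl Ei; apply: IH; rewrite -Ei; first exact: vl.
    exact: (irreducible_subst xl irr).
  apply: faithful_below_star faith; rewrite embed_subst.
  by apply: star_subterm; rewrite vars_embed.
have Ul j : joinable U (set_arg a i w' j) (a j).
  rewrite ffunE; case: eqP => [->|_]; last exact/star_joinable/rt_refl.
  exact/joinable_sym/star_joinable/rt_step.
split; last first.
  apply: eq_in_subst => x xl; rewrite ffunE; case: eqP => // Ei.
  by rewrite (IHl x xl Ei).2 -Ei.
split=> [x xl|].
  by rewrite ffunE; case: eqP => [/(IHl x xl)[]|_] //; apply: vl.
exists sigma; split=> // [x xl|x xi|].
- rewrite Hl // ffunE; case: eqP => // Ei.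
  by rewrite (IHl x xl Ei).2 -Ei.
- by apply: joinU_trans (Ul _) (Hi x xi).
- by apply: joinU_trans (Ul _) H0.
Qed.

Lemma irreducible_faithful n : irreducible (cstep R) n -> faithful n.
Proof.
move Ev: (emb n) => v.
elim/(plus_ind (subterm_or_step_wf U_wf)): v n Ev => v IH n Ev irr w Unw.
have faith : faithful_below n.
  by move=> m irr_m; rewrite Ev => /IH; apply.
(* The claim propagates along the reduction: each step keeps the back-translation equal to [n], so
   irreducibility and [faith] remain available. *)
suff: valid (emb n) /\ backtr (emb n) = n -> valid w /\ backtr w = n.
  by apply; split; [apply: valid_embed | apply: backtr_embed].
elim: Unw => [x y Uxy [vx Ex]|//|x y z _ IH1 _ IH2 /IH1 //].
by rewrite -Ex; apply: valid_step; rewrite ?Ex.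
Qed.

End Unraveling.

Theorem theorem22 (F : signature) (V : eqType)
    (V_countably_infinite : exists e : nat -> V, bijective e)
    (R : ctrs F V) (R_dctrs : dctrs R) (R_stable : right_stable R)
    (X : var_seqs F V) (X_orders : orders_vars R X)
    (U_confluent : confluent (rstep (useq R X)))
    (U_terminating : terminating (rstep (useq R X))) :
  confluent (cstep R).
Proof.
move=> s t1 t2 Rst1 Rst2.
have [n1 Rn1 irr1] := cstep_normal_form U_terminating t1.
have [n2 Rn2 irr2] := cstep_normal_form U_terminating t2.
have faith := irreducible_faithful X_orders R_dctrs R_stable U_confluent
  U_terminating.
have [v [Uv1 Uv2]] := U_confluent _ _ _
  (star_cstep_embed X (rt_trans _ _ _ _ _ Rst1 Rn1))
  (star_cstep_embed X (rt_trans _ _ _ _ _ Rst2 Rn2)).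
(* [n1] itself is the common reduct, since [v] back-translates to both [n1] and [n2]. *)
exists n1; split=> //.
have [_ <-] := faith _ irr1 _ Uv1.
by have [_ ->] := faith _ irr2 _ Uv2.
Qed.
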